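(* Let $n\geq 1$ be an integer, let $G$ be a simple graph and let $H$ be any undirected graph (loops allowed) with finite clique number $\omega(H)$. If $\chi(G)\leq \left(\omega(H)\right)^n$, then $\mathrm{C}(G;H)\leq n$. Thus, $$\mathrm{C}(G;H)\leq\min\{n\geq 1:~\chi(G)\leq \left(\omega(H)\right)^n\}.$$
   Context: Graphs here are undirected without multiple edges; a simple graph moreover has no loops. A homomorphism $f:G\to H$ is a map $f:V(G)\to V(H)$ with $f(u)f(v)\in E(H)$ whenever $uv\in E(G)$. A subgraph of $G$ is a graph whose vertex and edge sets are subsets of $V(G)$, $E(G)$. The union $G_1\cup\cdots\cup G_k$ has vertex set $\bigcup_i V(G_i)$ and edge set $\bigcup_i E(G_i)$. $\chi(G)$ is the chromatic number of $G$. The clique number is $\omega(H)=\max\{j:~H \text{ has a subgraph isomorphic to the complete graph } K_j\}$, where $K_j$ is the loopless complete graph on $j$ vertices. The hom-complexity $\mathrm{C}(G;H)$ is the least positive integer $k$ such that there are subgraphs $G_1,\dots,G_k$ of $G$ with $G=G_1\cup\cdots\cup G_k$ and, for each $i$, a homomorphism $G_i\to H$; $\mathrm{C}(G;H)=\infty$ if no such $k$ exists. The minimum of the empty set is $\infty$. *)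

(* Defs.v *)
From mathcomp Require Import all_boot.
From mathcomp Require Import boolp classical_sets.

Set Implicit Arguments.
Unset Strict Implicit.
Unset Printing Implicit Defensive.

Local Open Scope classical_set_scope.

(* Vertex types are arbitrary: graphs may be empty or infinite, which is why
   the numerical invariants below take values in the extended naturals. *)
Record graph := Graph {
  vertex :> Type;
  edge : vertex -> vertex -> Prop;
  edge_sym : forall u v, edge u v -> edge v u }.

Definition simple_graph (G : graph) := forall v : G, ~ edge v v.

Definition homomorphism (G H : graph) (f : G -> H) :=
  forall u v : G, edge u v -> edge (f u) (f v).

Definition isomorphic (G H : graph) :=
  exists f : G -> H,
    bijective f /\ forall u v : G, edge u v <-> edge (f u) (f v).

(* A subgraph need not be induced; in particular it may drop loops. *)
Record subgraph (G : graph) := Subgraph {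
  sub_vertex : set G;
  sub_edge : G -> G -> Prop;
  sub_edge_sym : forall u v, sub_edge u v -> sub_edge v u;
  sub_edge_vertex : forall u v, sub_edge u v -> sub_vertex u /\ sub_vertex v;
  sub_edge_edge : forall u v, sub_edge u v -> edge u v }.

Definition graph_of_subgraph (G : graph) (S : subgraph G) : graph :=
  @Graph {v : G | sub_vertex S v}
    (fun u v => sub_edge S (sval u) (sval v))
    (fun u v => @sub_edge_sym G S (sval u) (sval v)).
Coercion graph_of_subgraph : subgraph >-> graph.

Definition is_union (G : graph) (k : nat) (S : 'I_k -> subgraph G) :=
  (forall v : G, exists i, sub_vertex (S i) v) /\
  (forall u v : G, edge u v <-> exists i, sub_edge (S i) u v).

Lemma complete_edge_sym j (u v : 'I_j) : u <> v -> v <> u.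
Proof. by move=> uv vu; apply: uv. Qed.

Definition complete_graph (j : nat) : graph :=
  @Graph 'I_j (fun u v => u <> v) (@complete_edge_sym j).

Inductive enat := Fin of nat | Infty.

Definition le_enat (x y : enat) : bool :=
  match x, y with
  | _, Infty => true
  | Infty, Fin _ => false
  | Fin m, Fin n => m <= n
  end.

Notation "x <=e y" := (le_enat x y) (at level 70, no associativity).

Definition min_enat (P : set nat) : enat :=
  if pselect (exists n, `[< P n >]) is left ex then Fin (ex_minn ex)
  else Infty.

(* Only used for nonempty P, where Infty means that P is unbounded. *)
Definition max_enat (P : set nat) : enat :=
  if pselect (exists m, P m /\ forall j, P j -> j <= m) is left ex
  then Fin (sval (cid ex)) else Infty.

Definition proper_coloring (G : graph) (k : nat) (c : G -> 'I_k) :=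
  forall u v : G, edge u v -> c u <> c v.

Definition chromatic_number (G : graph) : enat :=
  min_enat [set k | exists c : G -> 'I_k, proper_coloring c].

Definition clique_number (H : graph) : enat :=
  max_enat [set j | exists S : subgraph H, isomorphic S (complete_graph j)].

Definition hom_complexity (G H : graph) : enat :=
  min_enat [set k | 0 < k /\
    exists S : 'I_k -> subgraph G,
      is_union S /\ forall i, exists f : S i -> H, homomorphism f].

(* Main.v *)
Require Import Defs.
From mathcomp Require Import all_boot.
From mathcomp Require Import boolp classical_sets.

Local Open Scope classical_set_scope.

(** A colouring with [w ^ n] colours is a colouring by words of length [n] over
    an alphabet of [w] letters.  The endpoints of an edge carry different words,
    so the edges of [G] are covered by the [n] spanning subgraphs [G_i] whose
    edges are those with different [i]-th letters; reading the [i]-th letter is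
    a homomorphism from [G_i] to [K_w], which maps into [H]. *)

Lemma min_enat_le (P : set nat) (n : nat) : P n -> min_enat P <=e Fin n.
Proof.
move=> Pn; rewrite /min_enat; case: pselect => [ex|[]] /=.
  by case: ex_minnP => m _; apply; apply/asboolP.
by exists n; apply/asboolP.
Qed.

Lemma min_enat_leP (P : set nat) (n : nat) :
  min_enat P <=e Fin n -> exists2 m, m <= n & P m.
Proof.
rewrite /min_enat; case: pselect => [ex|] //=.
by case: ex_minnP => m /asboolP Pm _ le_mn; exists m.
Qed.

Lemma le_min_enat (P : set nat) (x : enat) :
  (forall n, P n -> x <=e Fin n) -> x <=e min_enat P.
Proof.
(* If [P] is empty the minimum is [Infty], which bounds every [x]. *)
move=> xP; rewrite /min_enat; case: pselect => [ex|_]; last by case: x {xP}.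
by case: ex_minnP => m /asboolP /xP.
Qed.

Lemma max_enat_mem (P : set nat) (m : nat) : max_enat P = Fin m -> P m.
Proof.
by rewrite /max_enat; case: pselect => // ex [<-]; case: (svalP (cid ex)).
Qed.

(** A finite clique number is attained, so some subgraph [S] of [H] is a copy of the complete graph;
    the inverse [g] of the isomorphism, followed by the inclusion of [S], is the map. *)
Lemma complete_homomorphism (H : graph) (w : nat) :
  clique_number H = Fin w ->
  exists g : complete_graph w -> H, homomorphism g.
Proof.
move=> /max_enat_mem[S [f [[g fK gK] fE]]].
exists (fun a => sval (g a)) => a b ab.
apply: (@sub_edge_edge _ S); apply/(fE (g a) (g b)).
by rewrite !gK.
Qed.

Lemma word_coloring (G : graph) (w n : nat) :
  chromatic_number G <=e Fin (w ^ n) ->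
  exists c : G -> {ffun 'I_n -> 'I_w},
    forall u v : G, edge u v -> c u <> c v.
Proof.
move=> /min_enat_leP[k le_k [c c_proper]].
have le_card : k <= #|{ffun 'I_n -> 'I_w}| by rewrite card_ffun !card_ord.
(* The [k] colours inject into the [w ^ n] words: colour number [j] becomes the [j]-th word of an
   enumeration. *)
exists (fun v => enum_val (widen_ord le_card (c v))) => u v /c_proper cuv /enum_val_inj.
by move/(congr1 (@nat_of_ord _)) => eq_c; apply/cuv/ord_inj.
Qed.

Section CoordinateSubgraph.
Variables (G : graph) (I A : Type) (c : G -> I -> A) (i : I).

Let E (u v : G) := edge u v /\ c u i <> c v i.

Let E_sym u v : E u v -> E v u.
Proof. by move=> [/edge_sym vu cuv]; split=> // /esym. Qed.

Let E_vertex u v : E u v -> [set: G] u /\ [set: G] v.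
Proof. by []. Qed.

Let E_edge u v : E u v -> edge u v.
Proof. by case. Qed.

Definition coordinate_subgraph : subgraph G :=
  @Subgraph G setT E E_sym E_vertex E_edge.

End CoordinateSubgraph.

Lemma hom_complexity_le (G H : graph) (w n : nat) :
  clique_number H = Fin w -> 0 < n ->
  chromatic_number G <=e Fin (w ^ n) -> hom_complexity G H <=e Fin n.
Proof.
move=> /complete_homomorphism[g g_hom] n_gt0 /word_coloring[c c_proper].
apply: min_enat_le; split=> //.
exists (coordinate_subgraph G _ _ c); split; last first.
  move=> i; exists (fun v => g (c (sval v) i)) => u v [_ cuv].
  exact: g_hom.
(* Each coordinate subgraph contains all vertices, so index 0, available since [n] is positive,
   covers even isolated ones. *)
split=> [v|u v]; first by exists (Ordinal n_gt0).
split=> [uv|[i []]] //.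
have [i ci] : exists i, c u i <> c v i.
  (* Words that agree in every letter are equal, against properness. *)
  by apply/existsNP => eq_c; apply: (c_proper u v uv); apply/ffunP.
by exists i.
Qed.

Theorem theorem3p30 (G H : graph) (w : nat) :
  simple_graph G ->
  clique_number H = Fin w ->
  (forall n : nat, 1 <= n ->
     chromatic_number G <=e Fin (w ^ n) ->
     hom_complexity G H <=e Fin n) /\
  hom_complexity G H <=e
    min_enat [set n | 1 <= n /\ chromatic_number G <=e Fin (w ^ n)].
Proof.
move=> _ Hw; split=> [n|]; first exact: hom_complexity_le.
by apply: le_min_enat => n [n_gt0]; apply: hom_complexity_le.
Qed.
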